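(* Let $(G_n)_{n\in\mathbb N}$ be a sequence of finite random (multi-)graphs, $G_n$ having vertex set $[n]=\{1,\ldots,n\}$, that converges locally weakly to an almost surely locally finite, connected rooted random graph $(G,o)$. Let $\tilde\mu_n(\cdot)=\mathbb E_n\big[\frac1n\sum_{i\in[n]}\delta_{\Delta_{i,n}}(\cdot)\big]$ be the annealed friendship-bias empirical distribution of $G_n$, and let $\mu$ be the law of the friendship bias $\Delta_o^{(G)}$ of the root of $(G,o)$. Then $\tilde\mu_n$ converges weakly to $\mu$ as $n\to\infty$. In particular, $\tilde\mu_n(A)\to\mu(A)$ as $n\to\infty$ for every Borel set $A\subseteq\mathbb R$.
   Context: Graphs are undirected and may be multi-graphs. For a graph $G$, $A^{(G)}_{i,j}$ is the number of edges between $i$ and $j$ if $i\ne j$, and twice the number of self-loops at $i$ if $i=j$; $d_i^{(G)}=\sum_j A^{(G)}_{i,j}$ is the degree of $i$. Friendship bias of vertex $i\in[n]$ in $G_n$: $\Delta_{i,n}=\Big[\frac{\sum_{j\in[n]}A^{(G_n)}_{i,j}d_j^{(G_n)}}{d_i^{(G_n)}}-d_i^{(G_n)}\Big]$ if $d_i^{(G_n)}\neq0$, and $\Delta_{i,n}=0$ if $d_i^{(G_n)}=0$. Friendship bias of the root of a rooted graph $(G,o)$: $\Delta_o^{(G)}=\frac{\sum_{j\in V(G)}A^{(G)}_{o,j}d_j^{(G)}}{d_o^{(G)}}-d_o^{(G)}$ if $d_o^{(G)}\ne0$, and $0$ otherwise. $\mathbb E_n$ is expectation with respect to the random graph $G_n$;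 $\delta_x$ is the Dirac measure at $x$. Let $\mathscr G$ be the set of connected locally finite rooted graphs modulo (root-preserving) isomorphism $\simeq$. For a rooted graph $(G,o)$, $B_r^{(G)}(o)$ is the rooted subgraph with vertices at graph distance at most $r$ from $o$ and all edges of $G$ both of whose endpoints are within distance $r$ of $o$. Equip $\mathscr G$ with the metric $\mathrm d_{\mathscr G}((G_1,o_1),(G_2,o_2))=\big(1+\sup\{r\ge0: B_r^{(G_1)}(o_1)\simeq B_r^{(G_2)}(o_2)\}\big)^{-1}$. Local weak convergence: let $U_n$ be a uniformly chosen vertex of $G_n$ and let $\mathscr C(G_n,U_n)$ be the connected component of $U_n$ in $G_n$, rooted at $U_n$. $G_n$ converges locally weakly to $(G,o)$ with (deterministic) law $\tilde\nu$ if for every bounded continuous $h\colon\mathscr G\to\mathbb R$, $\mathbb E[h(\mathscr C(G_n,U_n))]\to\mathbb E_{\tilde\nu}[h((G,o))]$, where the first expectation is over both $G_n$ and $U_n$. *)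

(* Defs.v *)
From HB Require Import structures.
From mathcomp Require Import all_boot all_order all_algebra.
From mathcomp Require Import generic_quotient finmap.
From mathcomp Require Import all_classical all_reals all_analysis measurable_realfun.

Set Implicit Arguments.
Unset Strict Implicit.
Unset Printing Implicit Defensive.

Import Order.TTheory GRing.Theory Num.Theory.
Import numFieldNormedType.Exports.

Local Open Scope classical_set_scope.
Local Open Scope ring_scope.
Local Open Scope quotient_scope.

(* Undirected locally finite multigraphs whose vertices are natural numbers.
   [mult G i j] is the number of edges between [i] and [j]; in particular
   [mult G i i] is the number of self-loops at [i], each counted once.
   As connected locally finite graphs are countable, every element of the space
   of rooted graphs has a representative of this form. *)
Record mgraph := MGraph {
  vset : set nat ;
  mult : nat -> nat -> nat ;
  mult_sym : forall i j, mult i j = mult j i ;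
  mult_vset : forall i j, (0 < mult i j)%N -> vset i ;
  mult_fin : forall i, finite_set [set j | (0 < mult i j)%N] }.

Definition adjm (G : mgraph) (i j : nat) : nat :=
  if i == j then (2 * mult G i i)%N else mult G i j.

Definition degree (G : mgraph) (i : nat) : nat :=
  \sum_(j \in vset G) adjm G i j.

Definition fbias (R : realType) (G : mgraph) (i : nat) : R :=
  if degree G i == 0%N then 0
  else (\sum_(j \in vset G) ((adjm G i j)%:R * (degree G j)%:R : R))
         / (degree G i)%:R - (degree G i)%:R.

Definition edge (G : mgraph) : rel nat := fun i j => (0 < mult G i j)%N.

Definition walk (G : mgraph) (i j : nat) (p : seq nat) : Prop :=
  path (edge G) i p /\ last i p = j.

Definition reachable (G : mgraph) (i j : nat) : Prop := exists p, walk G i j p.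

(* The graph distance from [i] to [j] is at most [r]. *)
Definition dist_le (G : mgraph) (i : nat) (r : nat) (j : nat) : Prop :=
  exists2 p, walk G i j p & (size p <= r)%N.

Section Induced.
Variables (G : mgraph) (V : set nat).

Let imult (i j : nat) : nat := if `[< V i /\ V j >] then mult G i j else 0%N.

Let imult_sym i j : imult i j = imult j i.
Proof.
rewrite /imult mult_sym; congr (if _ then _ else _).
by apply: asbool_equiv_eq; split=> -[].
Qed.

Let imult_vset i j : (0 < imult i j)%N -> V i.
Proof. by rewrite /imult; case: asboolP => // -[]. Qed.

Let imult_fin i : finite_set [set j | (0 < imult i j)%N].
Proof.
by apply: sub_finite_set (mult_fin G i) => j /=; rewrite /imult; case: asboolP.
Qed.

Definition induced : mgraph := MGraph imult_sym imult_vset imult_fin.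

End Induced.

Definition ball_graph (G : mgraph) (o r : nat) : mgraph :=
  induced G [set v | dist_le G o r v].

(* [f] is an isomorphism from the rooted graph [(G, o)] to [(H, p)]. *)
Definition riso_by (G : mgraph) (o : nat) (H : mgraph) (p : nat)
    (f : nat -> nat) : Prop :=
  [/\ set_bij (vset G) (vset H) f, f o = p &
      forall i j, vset G i -> vset G j -> mult H (f i) (f j) = mult G i j].

Definition riso (G : mgraph) (o : nat) (H : mgraph) (p : nat) : Prop :=
  exists f, riso_by G o H p f.

Record rgraph := RGraph {
  rg_graph :> mgraph ;
  root : nat ;
  root_vset : vset rg_graph root ;
  rg_connected : forall v, vset rg_graph v -> reachable rg_graph root v }.

Lemma walk_rcons G i j k p :
  walk G i j p -> edge G j k -> walk G i k (rcons p k).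
Proof. by case=> pp <- e; split; rewrite ?last_rcons// rcons_path pp. Qed.

Lemma dist_leS G o r v :
  dist_le G o r.+1 v <->
  dist_le G o r v \/ exists2 u, dist_le G o r u & edge G u v.
Proof.
split=> [[p [pp lp] sp]|[[p wp sp]|[u [p wp sp] e]]]; first 1 last.
- by exists p => //; apply: leqW.
- by exists (rcons p v); [exact: walk_rcons e|rewrite size_rcons].
case: (lastP p) pp lp sp => [_ <- _|q x]; first by left; exists [::].
rewrite rcons_path last_rcons size_rcons ltnS => /andP[pq e] <- sq.
by right; exists (last o q) => //; exists q.
Qed.

Lemma dist_le0 G o v : dist_le G o 0 v <-> v = o.
Proof.
split=> [[p [_ <-]]|->]; first by rewrite leqn0 size_eq0 => /eqP ->.
by exists [::].
Qed.

Lemma dist_le_mono G o r s v : (r <= s)%N -> dist_le G o r v -> dist_le G o s v.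
Proof. by move=> rs [p wp sp]; exists p => //; apply: leq_trans rs. Qed.

Lemma dist_le_root G o r : dist_le G o r o.
Proof. by exists [::]. Qed.

Lemma reachable_dist G i j : reachable G i j <-> exists r, dist_le G i r j.
Proof. by split=> [[p wp]|[r [p wp _]]]; [exists (size p); exists p|exists p]. Qed.

Lemma edge_sym G i j : edge G i j = edge G j i.
Proof. by rewrite /edge mult_sym. Qed.

Lemma edge_vset G i j : edge G i j -> vset G j.
Proof. by rewrite edge_sym; exact: mult_vset. Qed.

Lemma dist_le_vset G o r v : vset G o -> dist_le G o r v -> vset G v.
Proof.
move=> Go; elim: r v => [v /dist_le0 ->//|r IH v].
by move=> /dist_leS[/IH//|[u _ /edge_vset]].
Qed.

Lemma dist_le_finite G o r : finite_set [set v | dist_le G o r v].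
Proof.
elim: r => [|r IH].
  have -> : [set v | dist_le G o 0 v] = [set o].
    by apply/seteqP; split=> v /=; [move/dist_le0|move=> ->; apply/dist_le0].
  exact: finite_set1.
have -> : [set v | dist_le G o r.+1 v] = [set v | dist_le G o r v] `|`
    \bigcup_(u in [set v | dist_le G o r v]) [set v | edge G u v].
  apply/seteqP; split=> v /=.
    by move=> /dist_leS[?|[u ? ?]]; [left|right; exists u].
  by move=> [?|[u ? ?]]; apply/dist_leS; [left|right; exists u].
rewrite finite_setU; split=> //; apply: bigcup_finite => // u _.
exact: mult_fin.
Qed.

Section Component.
Variables (G : mgraph) (i : nat).

Let compG : mgraph := induced G [set v | reachable G i v].

Let comp_root : vset compG i. Proof. by exists [::]. Qed.

Let comp_connected v : vset compG v -> reachable compG i v.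
Proof.
move=> /= /reachable_dist[r]; elim: r v => [v /dist_le0 ->|r IH v].
  by exists [::].
move=> /dist_leS[/IH//|[u ur uv]]; have [p wp] := IH _ ur.
exists (rcons p v); apply: walk_rcons wp _; rewrite /edge/=.
case: asboolP => // -[]; split; apply/reachable_dist; first by exists r.
by exists r.+1; apply/dist_leS; right; exists u.
Qed.

Definition component : rgraph := RGraph comp_root comp_connected.

End Component.

Lemma riso_by_id G o : riso_by G o G o id.
Proof. by split=> //; split=> [x Gx|x y _ _|x Gx] //; exists x. Qed.

Lemma riso_by_comp G o H p K q f g :
  riso_by G o H p f -> riso_by H p K q g -> riso_by G o K q (g \o f).
Proof.
move=> [bf fo mf] [bg gp mg]; split; last first.
- move=> i j Gi Gj /=; have [ff _ _] := bf.
  by rewrite mg ?mf//; exact: ff.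
- by rewrite /= fo.
- exact: set_bij_comp bg.
Qed.

Lemma riso_by_sym G o H p f : vset G o -> riso_by G o H p f ->
  exists g, [/\ riso_by H p G o g, forall v, vset G v -> g (f v) = v &
                forall w, vset H w -> f (g w) = w].
Proof.
move=> Go [[ff injf surjf] fo mf].
pose g w := xget o [set v | vset G v /\ f v = w].
have gP w : vset H w -> vset G (g w) /\ f (g w) = w.
  move=> /surjf[v Gv <-]; rewrite /g; case: xgetP => [x _ []//|].
  by move=> /(_ v)/=; case.
have gf v : vset G v -> g (f v) = v.
  move=> Gv; have [Gg fg] := gP _ (ff _ Gv).
  by apply: injf => //; rewrite inE.
exists g; split=> // [|w /gP[]//]; split; first split.
- by move=> w /gP[].
- by move=> w w'; rewrite !inE => /gP[_ {2}<-] /gP[_ {2}<-] ->.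
- by move=> v Gv; exists (f v); rewrite ?gf//; exact: ff.
- by rewrite -fo gf.
- move=> i j /gP[Gi fi] /gP[Gj fj]; by rewrite -mf// fi fj.
Qed.

Lemma riso_refl G o : riso G o G o.
Proof. by exists id; exact: riso_by_id. Qed.

Lemma riso_sym G o H p : vset G o -> riso G o H p -> riso H p G o.
Proof. by move=> Go [f /(riso_by_sym Go)[g [? _ _]]]; exists g. Qed.

Lemma riso_trans G o H p K q : riso G o H p -> riso H p K q -> riso G o K q.
Proof. by move=> [f fP] [g gP]; exists (g \o f); exact: riso_by_comp gP. Qed.

Lemma riso_by_edge G o H p f i j : riso_by G o H p f ->
  edge G i j -> edge H (f i) (f j).
Proof.
move=> [_ _ mf] e; rewrite /edge mf//; first exact: mult_vset e.
exact: edge_vset e.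
Qed.

Lemma riso_by_dist G o H p f r v : riso_by G o H p f ->
  dist_le G o r v -> dist_le H p r (f v).
Proof.
move=> fP; have [_ fo _] := fP.
elim: r v => [v /dist_le0 ->|r IH v]; first by rewrite fo; apply/dist_le0.
move=> /dist_leS[/IH ?|[u /IH ur /(riso_by_edge fP) e]]; apply/dist_leS.
  by left.
by right; exists (f u).
Qed.

Lemma riso_by_ball G o H p f r : vset G o -> riso_by G o H p f ->
  riso_by (ball_graph G o r) o (ball_graph H p r) p f.
Proof.
move=> Go fP; have [g [gP gf fg]] := riso_by_sym Go fP.
have [[ff injf _] fo mf] := fP; have Hp : vset H p by rewrite -fo; exact: ff.
have GV v : dist_le G o r v -> vset G v by exact: dist_le_vset.
split=> //; first split.
- by move=> v /(riso_by_dist fP).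
- by move=> v w; rewrite !inE => /GV ? /GV ?; apply: injf; rewrite inE.
- move=> w wr; exists (g w); first exact: riso_by_dist gP wr.
  by apply: fg; exact: dist_le_vset wr.
move=> i j /= ir jr.
by rewrite !asboolT ?mf//; [exact: GV|exact: GV|split; exact: (riso_by_dist fP)].
Qed.

Lemma ball_graph_dist G o r s v : (s <= r)%N ->
  dist_le (ball_graph G o r) o s v <-> dist_le G o s v.
Proof.
elim: s v => [v _|s IH v sr]; first by split=> /dist_le0 ->; apply/dist_le0.
have {}IH v' := IH v' (ltnW sr).
split=> /dist_leS[/IH ?|[u us e]]; apply/dist_leS; [by left| |by left|].
  right; exists u; first exact/IH.
  by move: e; rewrite /edge/=; case: asboolP.
right; exists u; first exact/IH.
rewrite /edge/= asboolT//; split; first exact: dist_le_mono (ltnW sr) us.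
by apply: dist_le_mono sr _; apply/dist_leS; right; exists u.
Qed.

Lemma mgraph_eq G H : vset G = vset H -> mult G = mult H -> G = H.
Proof.
case: G H => [V m a b c] [W m' a' b' c'] /= VW mm.
by subst W m'; congr MGraph; exact: Prop_irrelevance.
Qed.

Lemma ball_ball_graph G o r s : (s <= r)%N ->
  ball_graph (ball_graph G o r) o s = ball_graph G o s.
Proof.
move=> sr; have E v := ball_graph_dist G o v sr.
apply: mgraph_eq => /=; first by apply/seteqP; split=> v /E.
apply/funext => i; apply/funext => j.
have [[si sj]|n] := pselect (dist_le G o s i /\ dist_le G o s j).
  rewrite !asboolT//; first by split; exact: (dist_le_mono sr).
  by split; apply/E.
by rewrite !asboolF// => -[/E ? /E ?]; apply: n.
Qed.

Definition ball_riso (x y : rgraph) (r : nat) : Prop :=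
  riso (ball_graph x (root x) r) (root x) (ball_graph y (root y) r) (root y).

Lemma ball_riso_mono x y r s : (s <= r)%N -> ball_riso x y r -> ball_riso x y s.
Proof.
move=> sr [f fP]; exists f.
rewrite -(ball_ball_graph x _ sr) -(ball_ball_graph y _ sr).
by apply: riso_by_ball fP => //=; exact: dist_le_root.
Qed.

Lemma ball_riso_refl x r : ball_riso x x r.
Proof. exact: riso_refl. Qed.

Lemma ball_riso_sym x y r : ball_riso x y r -> ball_riso y x r.
Proof. by apply: riso_sym => /=; exact: dist_le_root. Qed.

Lemma ball_riso_trans x y z r :
  ball_riso x y r -> ball_riso y z r -> ball_riso x z r.
Proof. exact: riso_trans. Qed.

Lemma rgraph_ball (x : rgraph) v :
  vset x v <-> exists r, dist_le x (root x) r v.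
Proof.
split=> [/(rg_connected)/reachable_dist//|[r]].
by apply: dist_le_vset; exact: root_vset.
Qed.

(* Konig's lemma, via a free ultrafilter on the radii: rooted graphs all of
   whose balls are isomorphic are isomorphic. *)
Lemma ball_riso_all x y :
  (forall r, ball_riso x y r) -> riso x (root x) y (root y).
Proof.
move=> /choice[F FP].
have [U [UU sU]] := ultraFilterLemma eventually_filter.
have UF : ProperFilter U by exact: ultra_proper.
have Uge n : U [set r | (n <= r)%N] by apply: sU; exists n.
have pick (A : set nat) (h : nat -> nat) : finite_set A ->
    U [set r | A (h r)] -> exists2 a, A a & U [set r | h r = a].
  move=> /finite_fsetP[X ->] UA; apply: contrapT => nU.
  have Un a : a \in X -> U [set r | h r <> a].
    move=> aX; have [Ua|//] := in_ultra_setVsetC [set r | h r = a] UU.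
    by case: nU; exists a.
  have [r [/= hX]] := filter_ex (filterI UA (filter_bigI _ Un)).
  by move=> /(_ (h r) hX).
have Fdist v k r : (k <= r)%N -> dist_le x (root x) k v ->
    dist_le y (root y) k (F r v).
  move=> kr vk; apply/(ball_graph_dist _ _ _ kr).
  by apply: riso_by_dist (FP r) _; apply/(ball_graph_dist _ _ _ kr).
have /choice[f fP] v : exists w, vset x v ->
    vset y w /\ U [set r | F r v = w].
  have [/rgraph_ball[k vk]|nv] := pselect (vset x v); last by exists 0%N.
  have [||w wk Uw] := pick [set w | dist_le y (root y) k w] (F ^~ v).
  - exact: dist_le_finite.
  - by apply: filterS (Uge k) => r /= kr; exact: Fdist.
  - by exists w => _; split=> //; apply/rgraph_ball; exists k.
have inball v : vset x v ->
    U [set r | vset (ball_graph x (root x) r) v /\ F r v = f v].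
  move=> xv; have [_ Uv] := fP _ xv; have [k vk] := (rgraph_ball _ _).1 xv.
  apply: filterS2 (Uge k) Uv => r /= kr ->; split=> //.
  exact: dist_le_mono vk.
exists f; split; first split.
- by move=> v /fP[].
- move=> v w; rewrite !inE => xv xw fvw.
  have [r [[vr Fv] [wr Fw]]] := filter_ex (filterI (inball _ xv) (inball _ xw)).
  have [[_ inj _] _ _] := FP r.
  by apply: inj; rewrite ?inE// Fv Fw.
- move=> w /rgraph_ball[k wk].
  have /choice[g gP] r : exists v, (k <= r)%N ->
      dist_le x (root x) k v /\ F r v = w.
    have [kr|_] := leqP k r; last by exists 0%N.
    have xr : vset (ball_graph x (root x) r) (root x) by exact: dist_le_root.
    have [g [gP _ Fg]] := riso_by_sym xr (FP r).
    have wr : vset (ball_graph y (root y) r) w by exact: dist_le_mono wk.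
    exists (g w) => _; split; last exact: Fg.
    apply/(ball_graph_dist _ _ _ kr); apply: riso_by_dist gP _.
    exact/(ball_graph_dist _ _ _ kr).
  have [||v vk Uv] := pick [set v | dist_le x (root x) k v] g.
  + exact: dist_le_finite.
  + by apply: filterS (Uge k) => r /= /gP[].
  + have xv : vset x v by apply/rgraph_ball; exists k.
    exists v => //.
    have [r [[_ Fv] [kr gv]]] := filter_ex (filterI (inball _ xv)
      (filterI (Uge k) Uv)).
    by rewrite -Fv; have [_] := gP _ kr; rewrite gv.
- have [r [_ <-]] := filter_ex (inball _ (root_vset x)).
  by have [_ -> _] := FP r.
- move=> v w xv xw.
  have [r [[vr Fv] [wr Fw]]] := filter_ex (filterI (inball _ xv) (inball _ xw)).
  have [[ff _ _] _ mf] := FP r; move: (mf _ _ vr wr) => /=.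
  rewrite [in RHS]asboolT// asboolT; last by split; exact: ff.
  by rewrite Fv Fw.
Qed.

HB.instance Definition _ := gen_eqMixin rgraph.
HB.instance Definition _ := gen_choiceMixin rgraph.

Definition rgiso : rel rgraph := fun x y => `[< riso x (root x) y (root y) >].

Lemma rgiso_refl : reflexive rgiso.
Proof. by move=> x; apply/asboolP; exact: riso_refl. Qed.

Lemma rgiso_sym : symmetric rgiso.
Proof.
by move=> x y; apply/asboolP/asboolP; apply: riso_sym; exact: root_vset.
Qed.

Lemma rgiso_trans : transitive rgiso.
Proof.
by move=> y x z /asboolP xy /asboolP yz; apply/asboolP; exact: riso_trans yz.
Qed.

Canonical rgiso_equiv := EquivRel rgiso rgiso_refl rgiso_sym rgiso_trans.

(* Connected locally finite rooted graphs modulo isomorphism. The parameter [R]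
   is the field in which the metric defined below takes its values. *)
Definition rooted_graphs (R : realType) : Type := {eq_quot rgiso}.

HB.instance Definition _ (R : realType) :=
  Choice.copy (rooted_graphs R) {eq_quot rgiso}.

Definition rg_class (R : realType) (x : rgraph) : rooted_graphs R :=
  \pi_({eq_quot rgiso}) x.

Definition rg_repr (R : realType) (g : rooted_graphs R) : rgraph :=
  repr (g : {eq_quot rgiso}).

Section Distance.
Variable R : realType.
Implicit Types (g h k : rooted_graphs R).
Local Open Scope ereal_scope.

(* The supremum is taken in [0, +oo], so that it is 0 for the empty set. *)
Definition agree_radius g h : \bar R :=
  maxe 0 (ereal_sup
    [set r%:R%:E | r in [set r : nat | ball_riso (rg_repr g) (rg_repr h) r]]).

Definition rg_dist g h : R := fine (1 + agree_radius g h)^-1.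

Lemma agree_radius_ge0 g h : 0 <= agree_radius g h.
Proof. by rewrite /agree_radius le_max lexx. Qed.

Lemma agree_radius_ge g h r :
  ball_riso (rg_repr g) (rg_repr h) r -> r%:R%:E <= agree_radius g h.
Proof.
by move=> gh; rewrite /agree_radius le_max; apply/orP; right;
  apply: ereal_sup_ubound; exists r.
Qed.

Lemma agree_radius_gt g h (a : \bar R) : 0 <= a -> a < agree_radius g h ->
  exists2 r : nat, ball_riso (rg_repr g) (rg_repr h) r & a < r%:R%:E.
Proof.
move=> a0; rewrite /agree_radius lt_max ltNge a0/= => /ereal_sup_gt[_ [r gh <-]].
by exists r.
Qed.

Lemma agree_radius_le g h r :
  ~ ball_riso (rg_repr g) (rg_repr h) r.+1 -> agree_radius g h <= r%:R%:E.
Proof.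
move=> ngh; rewrite leNgt; apply/negP => /agree_radius_gt[]; first exact: lee0n.
by move=> s gh; rewrite lte_fin ltr_nat => rs; apply: ngh; exact: ball_riso_mono gh.
Qed.

Lemma agree_radius_min g h k :
  mine (agree_radius g h) (agree_radius h k) <= agree_radius g k.
Proof.
rewrite leNgt; apply/negP; rewrite lt_min => /andP[gh hk].
have [r rgh ra] := agree_radius_gt (agree_radius_ge0 g k) gh.
have [s shk sa] := agree_radius_gt (agree_radius_ge0 g k) hk.
have : ball_riso (rg_repr g) (rg_repr k) (minn r s).
  by apply: (@ball_riso_trans _ (rg_repr h)); [apply: ball_riso_mono rgh|
    apply: ball_riso_mono shk]; rewrite ?geq_minl ?geq_minr.
move=> /agree_radius_ge; rewrite leNgt => /negP; apply.
by rewrite /minn; case: ifP.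
Qed.

Lemma agree_radius_sym g h : agree_radius g h = agree_radius h g.
Proof.
rewrite /agree_radius; congr (maxe 0 (ereal_sup (_ @` _))).
by apply/seteqP; split=> r /=; exact: ball_riso_sym.
Qed.

Lemma agree_radius_refl g : agree_radius g g = +oo.
Proof.
apply/eqyP => e e0; apply: le_trans (agree_radius_ge (@ball_riso_refl _ (Num.bound e))).
by rewrite lee_fin; exact/ltW/archi_boundP/ltW.
Qed.

Let inv1D (a : \bar R) := fine (1 + a)^-1.

Let inv1D_fin (a : R) : (0 <= a)%R -> inv1D a%:E = (1 + a)^-1%R.
Proof.
move=> a0; rewrite /inv1D -EFinD inver gt_eqF//=.
by rewrite ltr_pwDl.
Qed.

Let inv1Dy : inv1D +oo = 0%R.
Proof. by rewrite /inv1D addey// invey. Qed.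

Let inv1D_anti (a b : \bar R) : 0 <= a -> a <= b -> (inv1D b <= inv1D a)%R.
Proof.
case: a b => [a| |] [b| |]//; rewrite ?lee_fin => a0 ab.
- rewrite !inv1D_fin ?(le_trans a0 ab)// lef_pV2 ?lerD2l// posrE ltr_pwDl//.
  exact: le_trans ab.
- by rewrite inv1Dy inv1D_fin// invr_ge0 addr_ge0.
Qed.

Lemma rg_dist_ultra g h k :
  (rg_dist g k <= Num.max (rg_dist g h) (rg_dist h k))%R.
Proof.
rewrite le_max; have := agree_radius_min g h k; rewrite ge_min.
by move=> /orP[le|le]; apply/orP; [left|right];
  apply: inv1D_anti => //; exact: agree_radius_ge0.
Qed.

Lemma rg_dist_ge0 g h : (0 <= rg_dist g h)%R.
Proof.
by rewrite fine_ge0// inve_ge0 adde_ge0// agree_radius_ge0.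
Qed.

Lemma rg_distxx g : rg_dist g g = 0%R.
Proof. by rewrite /rg_dist agree_radius_refl; exact: inv1Dy. Qed.

Lemma rg_dist_sym g h : rg_dist g h = rg_dist h g.
Proof. by rewrite /rg_dist agree_radius_sym. Qed.

Lemma rg_dist_triangle h g k : (rg_dist g k <= rg_dist g h + rg_dist h k)%R.
Proof.
rewrite (le_trans (rg_dist_ultra g h k))// ge_max.
by rewrite lerDl lerDr !rg_dist_ge0.
Qed.

Lemma rg_dist_lt g h r : (rg_dist g h < r.+1%:R^-1)%R ->
  ball_riso (rg_repr g) (rg_repr h) r.+1.
Proof.
move=> ghr; apply: contrapT => /agree_radius_le le; move: ghr.
rewrite ltNge => /negP; apply.
by rewrite -natr1 addrC -inv1D_fin//; apply: inv1D_anti; rewrite ?agree_radius_ge0.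
Qed.

Lemma rg_dist_eq0 g h : rg_dist g h = 0%R -> g = h.
Proof.
move=> gh; rewrite -[LHS](@reprK _ {eq_quot rgiso}) -[RHS](@reprK _ {eq_quot rgiso}).
apply/eqmodP/asboolP; apply: ball_riso_all => -[|r]; last first.
  by apply: rg_dist_lt; rewrite gh invr_gt0.
by apply: ball_riso_mono (leq0n 1) _; apply: rg_dist_lt; rewrite gh invr_gt0.
Qed.

HB.instance Definition _ := @isMetric.Build R (rooted_graphs R) rg_dist
  rg_distxx rg_dist_eq0 rg_dist_sym rg_dist_triangle.

End Distance.

Section Pointed.
Let mult0 (i j : nat) : nat := 0%N.
Let mult0_fin i : finite_set [set j | (0 < mult0 i j)%N].
Proof. by apply: sub_finite_set (@finite_set0 nat). Qed.

Definition edgeless : mgraph := @MGraph setT mult0 (fun _ _ => erefl)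
  (fun _ _ _ => I) mult0_fin.
End Pointed.

HB.instance Definition _ (R : realType) :=
  isPointed.Build (rooted_graphs R) (rg_class R (component edgeless 0)).

(* The Borel sigma-algebra. *)
HB.instance Definition _ (R : realType) := Measurable.copy (rooted_graphs R)
  (g_sigma_algebraType (@open (rooted_graphs R))).


Lemma adjm_edge G i j : ~~ edge G i j -> adjm G i j = 0%N.
Proof.
rewrite /edge -leqNgt leqn0 /adjm => /eqP ij0.
by case: eqP => [E|//]; move: ij0; rewrite -E => ->.
Qed.

Lemma sum_adjm (V : nmodType) G i (F : nat -> nat -> V) :
  (forall j, F 0%N j = 0) ->
  \sum_(j \in vset G) F (adjm G i j) j = \sum_(j \in [set: nat]) F (adjm G i j) j.
Proof.
move=> F0; rewrite fsbig_mkcond; apply: eq_fsbigr => j _; rewrite /patch.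
case: ifPn => // /negP jG; rewrite adjm_edge ?F0//.
by apply/negP => /edge_vset Gj; apply: jG; rewrite inE.
Qed.

Lemma degreeT G i : degree G i = \sum_(j \in [set: nat]) adjm G i j.
Proof. exact: (@sum_adjm nat G i (fun a _ => a)). Qed.

Section BallDegree.
Variables (G : mgraph) (o r : nat).
Let B := ball_graph G o r.+1.

Lemma ball_adjm i j : dist_le G o r i -> adjm B i j = adjm G i j.
Proof.
move=> ir; have ir1 : dist_le G o r.+1 i by exact: dist_le_mono ir.
have [ij|] := boolP (edge G i j).
  have jr1 : dist_le G o r.+1 j by apply/dist_leS; right; exists i.
  by rewrite /adjm /=; case: eqP => _; rewrite asboolT.
move=> nij; rewrite !adjm_edge//; apply: contra nij.
by rewrite /edge/=; case: asboolP.
Qed.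

Lemma ball_degree i : dist_le G o r i -> degree B i = degree G i.
Proof.
by move=> ir; rewrite !degreeT; apply: eq_fsbigr => j _; exact: ball_adjm.
Qed.

End BallDegree.

Section BiasLocal.
Variable R : realType.

Lemma fbias_ball G o : fbias R (ball_graph G o 2) o = fbias R G o.
Proof.
have oo r : dist_le G o r o by exact: dist_le_root.
rewrite /fbias ball_degree//; case: ifPn => // _; congr (_ / _ - _).
rewrite (@sum_adjm R _ _ (fun a j => a%:R * (degree _ j)%:R)) => [|j]; last first.
  by rewrite mul0r.
rewrite (@sum_adjm R _ _ (fun a j => a%:R * (degree _ j)%:R)) => [|j]; last first.
  by rewrite mul0r.
apply: eq_fsbigr => j _; rewrite ball_adjm//.
have [oj|/adjm_edge ->] := boolP (edge G o j); last by rewrite !mul0r.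
by rewrite ball_degree//; apply/dist_leS; right; exists o.
Qed.

Section Iso.
Variables (G H : mgraph) (o p : nat) (f : nat -> nat).
Hypothesis fP : riso_by G o H p f.

Lemma riso_adjm i j : vset G i -> vset G j -> adjm H (f i) (f j) = adjm G i j.
Proof.
have [[_ injf _] _ mf] := fP => Gi Gj; rewrite /adjm mf//.
have -> : (f i == f j) = (i == j).
  by apply/eqP/eqP => [/injf ->//|->//]; rewrite inE.
by rewrite mf.
Qed.

Lemma riso_degree i : vset G i -> degree H (f i) = degree G i.
Proof.
have [bf _ _] := fP => Gi; rewrite /degree (reindex_fsbig f (vset G))//.
by apply: eq_fsbigr => j; rewrite inE => Gj; exact: riso_adjm.
Qed.

Lemma riso_fbias : vset G o -> fbias R H p = fbias R G o.
Proof.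
have [bf <- _] := fP => Go; rewrite /fbias riso_degree//.
case: ifPn => // _; congr (_ / _ - _); rewrite (reindex_fsbig f (vset G))//.
by apply: eq_fsbigr => j; rewrite inE => Gj; rewrite riso_adjm// riso_degree.
Qed.

End Iso.

Definition root_bias (g : rooted_graphs R) : R :=
  fbias R (rg_repr g) (root (rg_repr g)).

Lemma ball_riso_fbias x y :
  ball_riso x y 2 -> fbias R x (root x) = fbias R y (root y).
Proof.
move=> [f /riso_fbias/(_ (dist_le_root _ _ _))].
by rewrite !fbias_ball => ->.
Qed.

Lemma root_bias_class x : root_bias (rg_class R x) = fbias R x (root x).
Proof.
apply: ball_riso_fbias.
have /eqmodP/asboolP[f fP] : repr (rg_class R x : {eq_quot rgiso}) = x
  %[mod {eq_quot rgiso}] by rewrite reprK.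
by exists f; apply: riso_by_ball fP; exact: root_vset.
Qed.

Lemma open_root_bias (A : set R) : open (root_bias @^-1` A).
Proof.
rewrite openE => g /= Ag; apply/nbhs_ballP; exists 2%:R^-1 => //=.
move=> h; rewrite ballEmdist/= => /rg_dist_lt/ball_riso_fbias E.
by rewrite /root_bias -E.
Qed.

Lemma measurable_root_bias : measurable_fun [set: rooted_graphs R] root_bias.
Proof.
move=> _ A _; rewrite setTI; apply: sub_sigma_algebra; exact: open_root_bias.
Qed.

HB.instance Definition _ := @isMeasurableFun.Build _ _ (rooted_graphs R) R
  root_bias measurable_root_bias.

End BiasLocal.

(* Measurability is with respect to the discrete sigma-algebra on the countable
   set of multigraphs with vertex set {1, ..., n}, i.e. of all multiplicities. *)
Record random_graph d (T : measurableType d) (n : nat) := RandomGraph {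
  rg_map :> T -> mgraph ;
  rg_vset : forall w, vset (rg_map w) = [set i | (1 <= i <= n)%N] ;
  rg_meas : forall i j, measurable_fun [set: T] (fun w => mult (rg_map w) i j) }.

Section Annealed.
Context d (T : measurableType d) (R : realType) (P : probability T R).
Variables (n : nat) (G : random_graph T n).

Lemma sum_rg_vset (V : nmodType) w (F : nat -> V) :
  \sum_(j \in vset (G w)) F j = \sum_(1 <= j < n.+1) F j.
Proof.
rewrite (fsbig_seq _ _ (iota_uniq _ _)) rg_vset; apply: eq_fsbigl.
by apply/seteqP; split=> j /=; rewrite mem_index_iota ltnS.
Qed.

Lemma measurable_adjm i j : measurable_fun [set: T] (fun w => adjm (G w) i j).
Proof.
rewrite /adjm; case: eqP => _; last exact: rg_meas.
by under eq_fun do rewrite mul2n -addnn; apply: measurable_fun_addn; exact: rg_meas.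
Qed.

Lemma measurable_degree i : measurable_fun [set: T] (fun w => degree (G w) i).
Proof.
rewrite /degree; under eq_fun do rewrite sum_rg_vset.
elim: (index_iota _ _) => [|j s IH].
  by under eq_fun do rewrite big_nil; exact: measurable_cst.
under eq_fun do rewrite big_cons.
by apply: measurable_fun_addn IH; exact: measurable_adjm.
Qed.

Let measurable_nat (f : T -> nat) (h : nat -> R) :
  measurable_fun [set: T] f -> measurable_fun [set: T] (h \o f).
Proof. by move=> mf; apply: measurableT_comp mf. Qed.

Lemma measurable_fbias i : measurable_fun [set: T] (fun w => fbias R (G w) i).
Proof.
have md := measurable_degree.
have -> : (fun w => fbias R (G w) i) = (fun w =>
    (\sum_(1 <= j < n.+1) (adjm (G w) i j)%:R * (degree (G w) j)%:R)
      * (degree (G w) i)%:R^-1 - (degree (G w) i)%:R).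
  apply/funext => w; rewrite /fbias sum_rg_vset; case: ifPn => // /eqP ->.
  by rewrite invr0 mulr0 subr0.
apply: measurable_funB; last exact: (measurable_nat (fun k => k%:R)).
apply: measurable_funM; last exact: (measurable_nat (fun k => k%:R^-1)).
apply: measurable_sum => j; apply: measurable_funM.
  exact/(measurable_nat (fun k => k%:R))/measurable_adjm.
exact: (measurable_nat (fun k => k%:R)).
Qed.

Local Open Scope ereal_scope.

Definition annealed (A : set R) : \bar R :=
  \int[P]_w (n%:R^-1%:E * \sum_(1 <= i < n.+1) \d_(fbias R (G w) i) A).

Let annealed0 : annealed set0 = 0.
Proof.
rewrite /annealed integral0_eq// => w _.
by rewrite big1 ?mule0// => i _; rewrite measure0.
Qed.

Let annealed_ge0 A : 0 <= annealed A.
Proof.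
apply: integral_ge0 => w _; apply: mule_ge0; first by rewrite lee_fin invr_ge0.
by apply: sume_ge0.
Qed.

Let annealed_sigma_additive : semi_sigma_additive annealed.
Proof.
move=> F mF tF mUF.
have c0 : (0 <= n%:R^-1 :> R)%R by rewrite invr_ge0.
have mD i A : measurable A ->
    measurable_fun [set: T] (fun w => \d_(fbias R (G w) i) A : \bar R).
  move=> mA.
  have m1 : measurable_fun [set: R] (fun x : R => \d_x A : \bar R).
    exact: measurable_fun_dirac.
  exact: (measurableT_comp m1 (measurable_fbias i)).
pose I A w : \bar R := n%:R^-1%:E * \sum_(1 <= i < n.+1) \d_(fbias R (G w) i) A.
have mI A : measurable A -> measurable_fun [set: T] (I A).
  by move=> mA; apply: measurable_funeM; apply: emeasurable_sum => i; exact: mD.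
have I0 A w : 0 <= I A w.
  by apply: mule_ge0; rewrite ?lee_fin//; apply: sume_ge0.
rewrite [X in _ --> X](_ : _ = \sum_(0 <= k <oo) annealed (F k)); last first.
  rewrite -[RHS]integral_nneseries//; first last.
  - by move=> k w _; exact: I0.
  - by move=> k; exact: mI.
  apply: eq_integral => w _; rewrite nneseriesZl//; last first.
    by move=> k _; apply: sume_ge0.
  congr (_ * _); rewrite nneseries_sum//; apply: eq_bigr => i _.
  by apply/esym/cvg_lim => //; exact: measure_semi_sigma_additive.
have := @is_cvg_ereal_nneg_natsum R (annealed \o F) 0%N.
by apply=> k _; exact: annealed_ge0.
Qed.

HB.instance Definition _ := isMeasure.Build _ _ _ annealed
  annealed0 annealed_ge0 annealed_sigma_additive.

End Annealed.

Definition bounded_continuous (R : realType) (S : topologicalType)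
    (h : S -> R) : Prop :=
  continuous h /\ exists M : R, forall x, `|h x| <= M.

(* The expectation on the left is over both [G n] and a uniformly chosen vertex
   of {1, ..., n}; the expectation over the latter is written as an average. *)
Definition local_weak_cvg (R : realType) (d : nat -> measure_display)
    (T : forall n, measurableType (d n)) (P : forall n, probability (T n) R)
    (G : forall n, random_graph (T n) n)
    (nu : probability (rooted_graphs R) R) : Prop :=
  forall h : rooted_graphs R -> R, bounded_continuous h ->
    'E_(P n)[fun w => (n%:R^-1 *
        \sum_(1 <= i < n.+1) h (rg_class R (component (G n w) i)))%R]%E
      @[n --> \oo] --> 'E_nu[h]%E.

Definition weak_cvg (R : realType) (m_ : nat -> {measure set R -> \bar R})
    (m : {measure set R -> \bar R}) : Prop :=
  forall f : R -> R, bounded_continuous f ->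
    (\int[m_ n]_x (f x)%:E)%E @[n --> \oo] --> (\int[m]_x (f x)%:E)%E.

(* Main.v *)
(** The friendship bias of the root depends only on the ball of radius 2 around
    it, so it is locally constant on the space of rooted graphs: for every
    function [f], continuous or not, [f \o root_bias] is continuous. Local weak
    convergence may thus be applied to [f \o root_bias] for every bounded
    measurable [f], in particular for indicators of Borel sets. *)
From HB Require Import structures.
Require Import Defs.
From mathcomp Require Import all_boot all_order all_algebra.
From mathcomp Require Import all_classical all_reals all_analysis measurable_realfun.

Import Order.TTheory GRing.Theory Num.Theory.
Import numFieldNormedType.Exports.

Local Open Scope classical_set_scope.
Local Open Scope ring_scope.

(** A walk from [i] never leaves the component of [i]. The component keeps the vertex names of [G],
    so the two balls are equal and not merely isomorphic. *)
Lemma ball_graph_component (G : mgraph) (i r : nat) :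
  ball_graph (component G i) i r = ball_graph G i r.
Proof.
have dE v : dist_le (component G i) i r v <-> dist_le G i r v.
  elim: r v => [v|r IH v]; first by split=> /dist_le0 ->; apply/dist_le0.
  split=> /dist_leS[/IH ?|[u ur e]]; apply/dist_leS; [by left| |by left|].
    by right; exists u; [exact/IH|move: e; rewrite /edge/=; case: asboolP].
  right; exists u; first exact/IH.
  rewrite /edge/= asboolT//; split; apply/reachable_dist; first by exists r.
  by exists r.+1; apply/dist_leS; right; exists u.
apply: mgraph_eq => /=; first by apply/seteqP; split=> v /dE.
apply/funext => v; apply/funext => w.
have [[vr wr]|n] := pselect (dist_le G i r v /\ dist_le G i r w).
  rewrite !asboolT//; last by split; exact/dE.
  by split; apply/reachable_dist; exists r.
by rewrite !asboolF// => -[/dE ? /dE ?]; apply: n.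
Qed.

(** Both sides are read off the ball of radius 2 around [i], which is the same in [G] and in the
    component. *)
Lemma root_bias_component (R : realType) (G : mgraph) (i : nat) :
  root_bias (rg_class R (component G i)) = fbias R G i.
Proof. by rewrite root_bias_class -fbias_ball ball_graph_component fbias_ball. Qed.

Lemma continuous_comp_root_bias (R : realType) (f : R -> R) :
  continuous (f \o @root_bias R).
Proof. by apply/continuousP => A _; rewrite comp_preimage; exact: open_root_bias. Qed.

Section AnnealedIntegral.
Context d (T : measurableType d) (R : realType) (P : probability T R).
Variables (n : nat) (G : random_graph T n).
Local Open Scope ereal_scope.

(** On Borel sets the annealed measure is [n^-1] times the sum of the laws of the biases of the [n]
    vertices. Integrating against each law is a change of variables. *)
Lemma ge0_integral_annealed (f : R -> R) : measurable_fun [set: R] f ->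
    (forall x, (0 <= f x)%R) ->
  \int[annealed P G]_x (f x)%:E =
  'E_P[fun w => (n%:R^-1 * \sum_(1 <= i < n.+1) f (fbias R (G w) i))%R].
Proof.
move=> mf f0.
(* This covers [n = 0], where the inverse is 0 by convention. *)
have c0 : (0 <= n%:R^-1 :> R)%R by rewrite invr_ge0.
have mb i : measurable_fun [set: T] (fun w => fbias R (G w) i).
  exact: measurable_fbias.
have mfb i : measurable_fun [set: T] (fun w => (f (fbias R (G w) i))%:E).
  by apply/measurable_EFinP; exact: measurableT_comp (mb i).
(* Vertices run from 1 to [n] but [msum] is indexed from 0, hence the shift. *)
pose bias i : {mfun T >-> R} := HB.pack (fun w => fbias R (G w) i.+1)
  (@isMeasurableFun.Build _ _ _ _ (fun w => fbias R (G w) i.+1) (mb i.+1)).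
pose m_ i : {measure set R -> \bar R} := distribution P (bias i).
have annealedE A : measurable A ->
    annealed P G A = mscale (NngNum c0) (msum m_ n) A.
  move=> mA; rewrite /mscale/= /msum.
  have mD i : measurable_fun [set: T] (fun w => \d_(fbias R (G w) i) A : \bar R).
    have m1 : measurable_fun [set: R] (fun x : R => \d_x A : \bar R).
      exact: measurable_fun_dirac.
    exact: measurableT_comp m1 (mb i).
  rewrite /annealed ge0_integralZl_EFin//; last 2 first.
  - by move=> w _; exact: sume_ge0.
  - exact: emeasurable_sum.
  congr (_ * _); rewrite ge0_integral_sum// big_add1 big_mkord.
  (* The mean Dirac mass of [A] is the probability that the bias lies in [A]. *)
  apply: eq_bigr => i _; transitivity (\int[P]_w (\1_(bias i @^-1` A) w)%:E).
    by apply: eq_integral => w _; rewrite diracE indicE.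
  by rewrite integral_indic ?setIT// -[X in measurable X]setTI; exact: (mb i.+1).
rewrite (eq_measure_integral (mscale (NngNum c0) (msum m_ n))); last first.
  by move=> A mA _; exact: annealedE.
rewrite ge0_integral_mscale//; last 2 first.
  exact/measurable_EFinP.
  by move=> x _; rewrite lee_fin.
rewrite ge0_integral_measure_sum//; last 2 first.
  by move=> x _; rewrite lee_fin.
  exact/measurable_EFinP.
rewrite expectation.unlock; under [RHS]eq_integral do rewrite EFinM -sumEFin.
rewrite ge0_integralZl_EFin//; last 2 first.
- by move=> w _; apply: sume_ge0 => i _; rewrite lee_fin.
- exact: emeasurable_sum.
congr (_ * _); rewrite ge0_integral_sum//; last by move=> i w _; rewrite lee_fin.
rewrite big_add1 big_mkord; apply: eq_bigr => i _.
by rewrite ge0_integral_distribution//; exact/measurable_EFinP.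
Qed.

End AnnealedIntegral.

Section Convergence.
Context {R : realType} {d : nat -> measure_display}
    {T : forall n, measurableType (d n)} {P : forall n, probability (T n) R}
    {G : forall n, random_graph (T n) n}
    {nu : probability (rooted_graphs R) R}.
Hypothesis lwc : local_weak_cvg P G nu.
Implicit Type f : R -> R.
Local Open Scope ereal_scope.
Local Notation law := (distribution nu (@root_bias R)).

(** Local weak convergence is applied to the test function [f \o root_bias]; its expectations are
    the integrals of [f] against the annealed measures and the limit law. *)
Lemma ge0_cvg_integral_annealed f (M : R) : measurable_fun [set: R] f ->
    (forall x, (0 <= f x <= M)%R) ->
  \int[annealed (P n) (G n)]_x (f x)%:E @[n --> \oo] --> \int[law]_x (f x)%:E.
Proof.
move=> mf fM; have f0 x : (0 <= f x)%R by have /andP[] := fM x.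
have bc : bounded_continuous (f \o @root_bias R).
  split; first exact: continuous_comp_root_bias.
  by exists M => x /=; have /andP[? ?] := fM (root_bias x); rewrite ger0_norm.
have -> : \int[law]_x (f x)%:E = 'E_nu[f \o @root_bias R].
  rewrite expectation.unlock ge0_integral_distribution//.
  exact/measurable_EFinP.
apply: cvg_trans (lwc _ bc); apply: near_eq_cvg; apply: nearW => n.
rewrite ge0_integral_annealed//; congr expectation; apply/funext => w.
by under eq_bigr do rewrite /= root_bias_component.
Qed.

(** The positive and negative parts of [f] take values in [[0, M]], so each is covered by the
    nonnegative case. *)
Lemma cvg_integral_annealed f (M : R) : measurable_fun [set: R] f ->
    (forall x, (`|f x| <= M)%R) ->
  \int[annealed (P n) (G n)]_x (f x)%:E @[n --> \oo] --> \int[law]_x (f x)%:E.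
Proof.
move=> mf fM.
have fi : law.-integrable [set: R] (EFin \o f).
  apply: measurable_bounded_integrable => //.
    by rewrite (le_lt_trans (probability_le1 _ _))// ltry.
  exists M; split; first exact: num_real.
  by move=> N MN x _ /=; exact: le_trans (fM x) (ltW MN).
have pos_cvg (g : R -> R) : measurable_fun [set: R] g -> (forall x, (`|g x| <= M)%R) ->
    \int[annealed (P n) (G n)]_x (EFin \o g)^\+ x @[n --> \oo] -->
    \int[law]_x (EFin \o g)^\+ x.
  move=> mg gM; rewrite funerpos; apply: (@ge0_cvg_integral_annealed _ M).
    exact: measurable_funrpos.
  move=> x; rewrite funrpos_ge0/= ge_max (le_trans (ler_norm _) (gM x)).
  exact: le_trans (gM x).
rewrite integralE; under eq_cvg do rewrite integralE.
apply: cvgeB; last 2 first.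
- exact: pos_cvg.
(* The negative part of [f] is the positive part of [- f]. *)
- rewrite -funeposN; apply: (pos_cvg (\- f)%R); first exact: measurable_funN.
  by move=> x; rewrite normrN.
(* Integrability under the limit law rules out [oo - oo]. *)
exact/fin_num_adde_defr/integrable_pos_fin_num.
Qed.

End Convergence.

Theorem theorem2p3 (R : realType) (d : nat -> measure_display)
    (T : forall n, measurableType (d n)) (P : forall n, probability (T n) R)
    (G : forall n, random_graph (T n) n)
    (nu : probability (rooted_graphs R) R) :
  local_weak_cvg P G nu ->
  weak_cvg (fun n => annealed (P n) (G n)) (distribution nu (@root_bias R)) /\
  forall A : set R, measurable A ->
    annealed (P n) (G n) A @[n --> \oo] --> distribution nu (@root_bias R) A.
Proof.
move=> lwc; split=> [f [cf [M fM]]|A mA].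
  by apply: cvg_integral_annealed fM => //; exact: continuous_measurable_fun.
(* The indicator of a Borel set is itself an admissible test function, with bound 1. *)
have integral_1E (m : {measure set R -> \bar R}) : m A = (\int[m]_x (\1_A x)%:E)%E.
  by rewrite integral_indic// setIT.
rewrite integral_1E; under eq_cvg do rewrite integral_1E.
apply: (ge0_cvg_integral_annealed lwc _ 1) => // x.
by rewrite indicE ler0n lern1 leq_b1.
Qed.
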